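(* Let $(A,\le,\odot,\rightarrow,0,1)$ be a bounded MLUB-complete residuated poset, $(T,R)$ a time frame with $R$ serial, and $P,F,H,G$ the tense operators induced by $(T,R)$. Then for all $C_1,C_2,D_1,D_2,B_1,B_2\in\mathcal P_+(A^T)$: (DT1) $G(U(C_1))\boxdot G(U(C_2))\le\operatorname{Min}U(G(U(C_1\boxdot C_2)))$ and $G(B_1\Rightarrow B_2)\le G(U(B_1))\Rightarrow G(U(B_2))$; (DT2) $L(P(D_1\boxdot D_2))\le U(L(P(D_1))\boxdot L(P(D_2)))$; (DT3) $H(U(C_1))\boxdot H(U(C_2))\le\operatorname{Min}U(H(U(C_1\boxdot C_2)))$ and $H(B_1\Rightarrow B_2)\le H(U(B_1))\Rightarrow H(U(B_2))$; (DT4) $L(F(D_1\boxdot D_2))\le U(L(F(D_1))\boxdot L(F(D_2)))$.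
   Context: A residuated poset $(A,\le,\odot,\rightarrow,0,1)$ is a bounded poset with binary operations $\odot,\rightarrow:A\times A\to A$ such that for all $x,y,z,v$: $x\odot1=x$; $x\odot y=y\odot x$; $\odot$ associative; $x\le v,y\le z$ imply $x\odot y\le v\odot z$; $x\odot y\le z$ iff $x\le y\rightarrow z$. For subsets $X$ of a poset: $L(X)$, $U(X)$ are the sets of lower/upper bounds, $\operatorname{Max}X,\operatorname{Min}X$ the maximal/minimal elements; for subsets $X,Y$, $X\le Y$ iff $x\le y$ for all $x\in X,y\in Y$. MLUB-complete: for every nonempty $M$, every upper bound of $M$ lies above a minimal upper bound and every lower bound below a maximal lower bound. $\mathcal P_+(X)$ = nonempty subsets. In a residuated poset, for nonempty subsets $B,C$: $B\boxdot C=\operatorname{Max}LU(\{b\odot c\mid b\in B,c\in C\})$ and $B\Rightarrow C=\operatorname{Min}U(\bigcap\{L(b\rightarrow d)\mid b\in B,d\in U(C)\})$. $A^T$ is a residuated poset with componentwise order and operations, and for subsets of $A^T$ all of $L,U,\operatorname{Max},\operatorname{Min},\le,\boxdot,\Rightarrow$ are computed in $A^T$. A time frame is $(T,R)$, $T\ne\emptyset$, $R\subseteq T^2$; serial: each $s$ has $r,t$ with $rRs$, $sRt$. The induced tense operators $P,F,H,G:\mathcal P_+(A^T)\to(\mathcal P_+A)^T$ are $P(B)(s)=\operatorname{Min}U(\{q(t)\mid q\in B,tRs\})$, $F(B)(s)=\operatorname{Min}U(\{q(t)\mid q\in B,sRt\})$, $H(B)(s)=\operatorname{Max}L(\{q(t)\mid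 q\in B,tRs\})$, $G(B)(s)=\operatorname{Max}L(\{q(t)\mid q\in B,sRt\})$ (with $L,U$ in $A$). Every $Z\in(\mathcal P_+A)^T$ is identified with the subset $\{q\in A^T\mid q(t)\in Z(t)\ \forall t\}$ of $A^T$, and it is in this form that it enters $L,U,\boxdot,\Rightarrow,\le$ and the tense operators. *)

(* Defs.v *)
From HB Require Import structures.
From mathcomp Require Import all_boot all_order.
From mathcomp Require Import boolp classical_sets.

Set Implicit Arguments.
Unset Strict Implicit.
Unset Printing Implicit Defensive.

Import Order.TTheory.

Local Open Scope classical_set_scope.
Local Open Scope order_scope.

(* The constants 0 and 1 of a residuated poset are \bot and \top. *)
#[key="A"]
HB.mixin Record isResiduatedPOrder (d : Order.disp_t) A
    of Order.TBPOrder d A := {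
  rmul : A -> A -> A;
  rimp : A -> A -> A;
  rmulx1 : forall x : A, rmul x (\top : A) = x;
  rmulC : forall x y : A, rmul x y = rmul y x;
  rmulA : forall x y z : A, rmul x (rmul y z) = rmul (rmul x y) z;
  rmul_le : forall x y z v : A, x <= v -> y <= z -> rmul x y <= rmul v z;
  rmul_rimp : forall x y z : A, (rmul x y <= z) = (x <= rimp y z);
}.

#[short(type="residuatedPOrderType")]
HB.structure Definition ResiduatedPOrder (d : Order.disp_t) :=
  { A of Order.TBPOrder d A & isResiduatedPOrder d A }.

(* The residuated poset A^T; its order is the pointwise one of boolp. *)
Section FunctionBounds.
Variables (T : Type) (d : Order.disp_t) (A : tbPOrderType d).

Let fun_le0x (f : T -> A) : (fun=> \bot : A) <= f.
Proof. by apply/lefP => t; exact: le0x. Qed.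

Let fun_lex1 (f : T -> A) : f <= (fun=> \top : A).
Proof. by apply/lefP => t; exact: lex1. Qed.

HB.instance Definition _ :=
  @Order.hasBottom.Build FunOrder.fun_display (T -> A) _ fun_le0x.
HB.instance Definition _ :=
  @Order.hasTop.Build FunOrder.fun_display (T -> A) _ fun_lex1.

End FunctionBounds.

Section FunctionResiduated.
Variables (T : Type) (d : Order.disp_t) (A : residuatedPOrderType d).
Implicit Types f g h k : T -> A.

Definition fun_rmul f g : T -> A := fun t => rmul (f t) (g t).
Definition fun_rimp f g : T -> A := fun t => rimp (f t) (g t).

Let fun_rmulx1 f : fun_rmul f (\top : T -> A) = f.
Proof. by apply/funext => t; exact: rmulx1. Qed.

Let fun_rmulC f g : fun_rmul f g = fun_rmul g f.
Proof. by apply/funext => t; exact: rmulC. Qed.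

Let fun_rmulA f g h :
  fun_rmul f (fun_rmul g h) = fun_rmul (fun_rmul f g) h.
Proof. by apply/funext => t; exact: rmulA. Qed.

Let fun_rmul_le f g h k : f <= k -> g <= h -> fun_rmul f g <= fun_rmul k h.
Proof.
by move=> /lefP fk /lefP gh; apply/lefP => t; exact: rmul_le (fk t) (gh t).
Qed.

Let fun_rmul_rimp f g h : (fun_rmul f g <= h) = (f <= fun_rimp g h).
Proof.
by apply/lefP/lefP => fgh t; move: (fgh t); rewrite /fun_rmul rmul_rimp.
Qed.

HB.instance Definition _ :=
  @isResiduatedPOrder.Build FunOrder.fun_display (T -> A) fun_rmul fun_rimp
    fun_rmulx1 fun_rmulC fun_rmulA fun_rmul_le fun_rmul_rimp.

End FunctionResiduated.

Section PosetSubsets.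
Variables (d : Order.disp_t) (A : porderType d).
Implicit Types X Y M : set A.

Definition Max X : set A := [set x | X x /\ forall y, X y -> x <= y -> y = x].
Definition Min X : set A := [set x | X x /\ forall y, X y -> y <= x -> y = x].

Definition set_le X Y : Prop := forall x y, X x -> Y y -> x <= y.

Definition MLUB_complete : Prop := forall M, M !=set0 ->
  (forall x, ubound M x -> exists2 y, Min (ubound M) y & y <= x) /\
  (forall x, lbound M x -> exists2 y, Max (lbound M) y & x <= y).

End PosetSubsets.

Arguments MLUB_complete {d} A.

Section ResiduatedSubsets.
Variables (d : Order.disp_t) (A : residuatedPOrderType d).
Implicit Types B C : set A.

Definition boxdot B C : set A :=
  Max (lbound (ubound [set rmul b c | b in B & c in C])).

Definition boximp B C : set A :=
  Min (ubound (\bigcap_(p in B `*` ubound C) lbound [set rimp p.1 p.2])).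

End ResiduatedSubsets.

Definition serial (T : Type) (R : T -> T -> Prop) : Prop :=
  forall s, (exists r, R r s) /\ (exists t, R s t).

Section Tense.
Variables (d : Order.disp_t) (A : porderType d) (T : Type).

(* The identification of Z, a family of subsets of A, with a subset of A^T. *)
Definition sections (Z : T -> set A) : set (T -> A) :=
  [set q | forall t, Z t (q t)].

Variable R : T -> T -> Prop.
Implicit Types B : set (T -> A).

Definition tenseP B : T -> set A := fun s =>
  Min (ubound [set q t | q in B & t in [set t | R t s]]).
Definition tenseF B : T -> set A := fun s =>
  Min (ubound [set q t | q in B & t in [set t | R s t]]).
Definition tenseH B : T -> set A := fun s =>
  Max (lbound [set q t | q in B & t in [set t | R t s]]).
Definition tenseG B : T -> set A := fun s =>
  Max (lbound [set q t | q in B & t in [set t | R s t]]).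

End Tense.

(* Main.v *)
Require Import Defs.
From HB Require Import structures.
From mathcomp Require Import all_boot all_order.
From mathcomp Require Import boolp classical_sets.

Local Open Scope classical_set_scope.

(** MLUB-completeness passes from A to A^T and makes Max and Min harmless:
  Min U(M) and U(M) have the same lower bounds, Max L(M) and L(M) the same
  upper bounds.  Bounds in A^T are computed pointwise, since a value at a single
  point of T can be extended by the top or the bottom element.  The inequalities
  then reduce to residuation at single points of T: for instance, if q is an
  upper bound of C1 ⊙ C2, then c2 → q bounds C1 from above, hence
  g1(s) <= c2(t) → q(t) whenever s R t, that is c2(t) <= g1(s) → q(t), and
  therefore g1(s) ⊙ g2(s) <= q(t).  H and F are G and P for the converse of R. *)

Import Order.TTheory.
Local Open Scope order_scope.

(** * Upper and lower bounds in a poset *)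

Section Bounds.
Context {d : Order.disp_t} {A : porderType d}.
Implicit Types M : set A.

Lemma lbound_Min_ubound M : MLUB_complete A -> M !=set0 ->
  lbound (Min (ubound M)) = lbound (ubound M).
Proof.
move=> cA M0; apply/seteqP; split=> x xM y.
- by move=> /(proj1 (cA _ M0)) [z zM zy]; exact: le_trans (xM _ zM) zy.
- by case=> yM _; exact: xM.
Qed.

Lemma ubound_Max_lbound M : MLUB_complete A -> M !=set0 ->
  ubound (Max (lbound M)) = ubound (lbound M).
Proof.
move=> cA M0; apply/seteqP; split=> x xM y.
- by move=> /(proj2 (cA _ M0)) [z zM yz]; exact: le_trans yz (xM _ zM).
- by case=> yM _; exact: xM.
Qed.

Lemma ubound_lbound_ubound M : ubound (lbound (ubound M)) = ubound M.
Proof.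
apply/seteqP; split=> x xM y yM; last exact: yM.
by apply: xM => z; exact.
Qed.

Lemma lbound_ubound_lbound M : lbound (ubound (lbound M)) = lbound M.
Proof.
apply/seteqP; split=> x xM y yM; last exact: yM.
by apply: xM => z; exact.
Qed.

End Bounds.

Lemma ubound_top {d : Order.disp_t} {A : tPOrderType d} (M : set A) :
  ubound M !=set0.
Proof. by exists \top => x _; exact: lex1. Qed.

Lemma lbound_bot {d : Order.disp_t} {A : bPOrderType d} (M : set A) :
  lbound M !=set0.
Proof. by exists \bot => x _; exact: le0x. Qed.

(** * Bounds and tense operators in the function poset *)

Section Functions.
Context {d : Order.disp_t} {A : tbPOrderType d} {T : Type}.
Implicit Types (M : set (T -> A)) (Z : T -> set A) (f : T -> A) (s : T).

(** At each [s] a minimal upper bound of the values of [M] at [s] is chosen below [x s]; minimality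
    at every point makes the assembled function minimal. Lower bounds are dual. *)
Lemma MLUB_complete_fun : MLUB_complete A -> MLUB_complete (T -> A).
Proof.
move=> cA M [m Mm]; split=> x xM.
- have /choice [y yP] : forall s, exists a,
      Min (ubound [set q s | q in M]) a /\ a <= x s.
    move=> s; have M0 : [set q s | q in M] !=set0 by exists (m s), m.
    have [|a aM ax] := proj1 (cA _ M0) (x s); last by exists a.
    by move=> _ [q Mq <-]; exact/lefP/xM.
  exists y; last by apply/lefP => s; exact: (yP s).2.
  split=> [q Mq|z zM /lefP zy].
    by apply/lefP => s; apply: (yP s).1.1; exists q.
  apply/funext => s; apply: (yP s).1.2 (zy s).
  by move=> _ [q Mq <-]; exact/lefP/zM.
- have /choice [y yP] : forall s, exists a,
      Max (lbound [set q s | q in M]) a /\ x s <= a.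
    move=> s; have M0 : [set q s | q in M] !=set0 by exists (m s), m.
    have [|a aM ax] := proj2 (cA _ M0) (x s); last by exists a.
    by move=> _ [q Mq <-]; exact/lefP/xM.
  exists y; last by apply/lefP => s; exact: (yP s).2.
  split=> [q Mq|z zM /lefP zy].
    by apply/lefP => s; apply: (yP s).1.1; exists q.
  apply/funext => s; apply: (yP s).1.2 (zy s).
  by move=> _ [q Mq <-]; exact/lefP/zM.
Qed.

(** [T] is an arbitrary type, so equality with [s] is decided classically. *)
Definition set_at s (a : A) f : T -> A :=
  fun t => if `[< t = s >] then a else f t.

Lemma set_at_eq s a f : set_at s a f s = a.
Proof. by rewrite /set_at; case: asboolP. Qed.

Lemma ubound_at M s a :
  (forall q, M q -> q s <= a) <-> ubound M (set_at s a (\top : T -> A)).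
Proof.
split=> [aM q Mq|aM q Mq]; last by have /lefP/(_ s) := aM q Mq; rewrite set_at_eq.
apply/lefP => t; rewrite /set_at; case: asboolP => [->|_]; first exact: aM.
exact: lex1.
Qed.

Lemma lbound_at M s a :
  (forall q, M q -> a <= q s) <-> lbound M (set_at s a (\bot : T -> A)).
Proof.
split=> [aM q Mq|aM q Mq]; last by have /lefP/(_ s) := aM q Mq; rewrite set_at_eq.
apply/lefP => t; rewrite /set_at; case: asboolP => [->|_]; first exact: aM.
exact: le0x.
Qed.

(** Choice supplies the values away from [s]; a single empty [Z t] would leave no section at all. *)
Lemma sections_value Z s a : (forall t, Z t !=set0) -> Z s a ->
  exists2 q, sections Z q & q s = a.
Proof.
move=> /choice [f Zf] Zsa; exists (set_at s a f); last exact: set_at_eq.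
by move=> t; rewrite /set_at; case: asboolP => [->|_]; last exact: Zf.
Qed.

Lemma lbound_sectionsP Z f : (forall t, Z t !=set0) ->
  lbound (sections Z) f <-> forall t, lbound (Z t) (f t).
Proof.
move=> Z0; split=> [fZ t a Zta|fZ q Zq]; last by apply/lefP => t; exact: fZ.
by have [q Zq <-] := sections_value Z t a Z0 Zta; exact/lefP/fZ.
Qed.

Variable R : T -> T -> Prop.
Hypotheses (A_MLUB : MLUB_complete A) (R_serial : serial R).

(** Seriality makes the values of [M] at the successors of [s] a nonempty set, so completeness
    yields a maximal lower bound above [f s]. Bounds of [G] thus become bounds of [f]. *)
Lemma tenseG_above M f : M !=set0 ->
  (forall s t q, R s t -> M q -> f s <= q t) ->
  exists2 g, sections (tenseG R M) g & f <= g.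
Proof.
move=> [m Mm] fM.
have /choice [g gP] : forall s, exists a, tenseG R M s a /\ f s <= a.
  move=> s; have [_ [t Rst]] := R_serial s.
  have N0 : [set q t | q in M & t in [set t | R s t]] !=set0.
    by exists (m t), m => //; exists t.
  have [|a aM fa] := proj2 (A_MLUB _ N0) (f s); last by exists a.
  by move=> _ [q Mq [u Rsu <-]]; exact: fM.
exists g; first by move=> s; exact: (gP s).1.
by apply/lefP => s; exact: (gP s).2.
Qed.

Lemma tenseG_le M g s t q :
  sections (tenseG R M) g -> R s t -> M q -> g s <= q t.
Proof. by move=> /(_ s)[gM _] Rst Mq; apply: gM; exists q => //; exists t. Qed.

Lemma lbound_tenseP_le M f s a : M !=set0 -> lbound (sections (tenseP R M)) f ->
  (forall t q, R t s -> M q -> q t <= a) -> f s <= a.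
Proof.
move=> [m Mm].
have N0 u : [set q t | q in M & t in [set t | R t u]] !=set0.
  by have [[t Rtu] _] := R_serial u; exists (m t), m => //; exists t.
rewrite lbound_sectionsP; last first.
  (* A minimal upper bound below [\top] shows that [tenseP R M u] is nonempty. *)
  move=> u; have [|b bM _] := proj1 (A_MLUB _ (N0 u)) \top; last by exists b.
  by move=> x _; exact: lex1.
move=> /(_ s) + aM; rewrite /tenseP lbound_Min_ubound //; apply.
by move=> _ [q Mq [t Rts <-]]; exact: aM.
Qed.

Lemma tenseP_ge M p s t q :
  sections (tenseP R M) p -> R t s -> M q -> q t <= p s.
Proof. by move=> /(_ s)[pM _] Rts Mq; apply: pM; exists q => //; exists t. Qed.

End Functions.

(** * Bounds of the set operations of a residuated poset *)

Section ResiduatedBounds.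
Context {d : Order.disp_t} {A : residuatedPOrderType d}.
Hypothesis A_MLUB : MLUB_complete A.
Implicit Types B C : set A.

Lemma ubound_boxdot B C :
  ubound (boxdot B C) = ubound [set rmul b c | b in B & c in C].
Proof.
by rewrite /boxdot (ubound_Max_lbound _ A_MLUB (ubound_top _))
  ubound_lbound_ubound.
Qed.

Lemma boxdot_neq0 B C : boxdot B C !=set0.
Proof.
have [|y yM _] := proj2 (A_MLUB _ (ubound_top [set rmul b c | b in B & c in C]))
  \bot; last by exists y.
by move=> x _; exact: le0x.
Qed.

Lemma rimp_bigcapE B C :
  \bigcap_(p in B `*` ubound C) lbound [set rimp p.1 p.2] =
  lbound [set rimp b e | b in B & e in ubound C].
Proof.
apply/seteqP; split=> x xM.
- by move=> _ [b Bb [e Ce <-]]; apply: (xM (b, e)).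
- by case=> b e [/= Bb Ce] _ ->; apply: xM; exists b => //; exists e.
Qed.

Lemma lbound_boximp B C :
  lbound (boximp B C) = lbound [set rimp b e | b in B & e in ubound C].
Proof.
by rewrite /boximp rimp_bigcapE (lbound_Min_ubound _ A_MLUB (lbound_bot _))
  lbound_ubound_lbound.
Qed.

(** Elements of [boximp B C] lie above every common lower bound of the residuals, and residuation
    makes [x] one. *)
Lemma le_boximp B C x :
  (forall b e, B b -> ubound C e -> rmul x b <= e) -> set_le [set x] (boximp B C).
Proof.
move=> xBC _ y -> [yU _]; apply: yU; rewrite rimp_bigcapE.
by move=> _ [b Bb [e Ce <-]]; rewrite -rmul_rimp; exact: xBC.
Qed.

End ResiduatedBounds.

(** * The inequalities for [G] and [P] *)

Section TenseInequalities.
Context {d : Order.disp_t} {A : residuatedPOrderType d} {T : Type}.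
Variable R : T -> T -> Prop.
Hypotheses (A_MLUB : MLUB_complete A) (R_serial : serial R).
Implicit Types B C D : set (T -> A).

Let AT_MLUB : MLUB_complete (T -> A) := MLUB_complete_fun A_MLUB.

Lemma tenseG_boxdot C1 C2 :
  set_le (boxdot (sections (tenseG R (ubound C1)))
                 (sections (tenseG R (ubound C2))))
         (Min (ubound (sections (tenseG R (ubound (boxdot C1 C2)))))).
Proof.
move=> x y [xLU _] [yU _]; apply: xLU => _ [g1 g1P [g2 g2P <-]].
have [|g gP le_g] := tenseG_above R A_MLUB R_serial
    (ubound (boxdot C1 C2)) (rmul g1 g2) (ubound_top _); last first.
  exact: le_trans le_g (yU _ gP).
move=> s t q Rst; rewrite (ubound_boxdot AT_MLUB) => qC.
change (rmul (g1 s) (g2 s) <= q t); rewrite rmulC rmul_rimp.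
(* The residual is read as the value at [t] of a function equal to [\top] elsewhere; [g2 s] lies
   below it once that function bounds [C2] from above. *)
rewrite -(set_at_eq t (rimp (g1 s) (q t)) \top).
apply: (tenseG_le _ _ _ _ _ _ g2P Rst); apply/ubound_at => c2 Cc2.
rewrite -rmul_rimp rmulC rmul_rimp.
apply: (tenseG_le R (ubound C1) g1 s t (rimp c2 q)) => // c1 Cc1.
by rewrite -rmul_rimp; apply: qC; exists c1 => //; exists c2.
Qed.

Lemma tenseG_boximp B1 B2 :
  set_le (sections (tenseG R (boximp B1 B2)))
         (boximp (sections (tenseG R (ubound B1)))
                 (sections (tenseG R (ubound B2)))).
Proof.
move=> x y xP; apply: le_boximp => // g h gP hU.
have [|k kP le_k] := tenseG_above R A_MLUB R_serial
    (ubound B2) (rmul x g) (ubound_top _); last exact: le_trans le_k (hU _ kP).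
move=> s t e Rst eB; change (rmul (x s) (g s) <= e t).
rewrite rmulC rmul_rimp.
rewrite -(set_at_eq t (rimp (x s) (e t)) \top).
apply: (tenseG_le _ _ _ _ _ _ gP Rst); apply/ubound_at => b Bb.
rewrite -rmul_rimp rmulC rmul_rimp.
(* The value of [x] at [s] is moved to [t], where it lies below every value of [boximp B1 B2], hence
   below the residuals [rimp b e]. *)
have : lbound (boximp B1 B2) (set_at t (x s) \bot).
  by apply/lbound_at => q qB; exact: tenseG_le xP Rst qB.
rewrite (lbound_boximp AT_MLUB) => /lbound_at/(_ (rimp b e)); apply.
by exists b => //; exists e.
Qed.

Lemma tenseP_boxdot D1 D2 :
  set_le (lbound (sections (tenseP R (boxdot D1 D2))))
         (ubound (boxdot (lbound (sections (tenseP R D1)))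
                         (lbound (sections (tenseP R D2))))).
Proof.
move=> x y xP; rewrite (ubound_boxdot AT_MLUB) => yU; apply/lefP => s.
apply: (lbound_tenseP_le R A_MLUB R_serial _ _ _ _ _ xP).
  exact: (boxdot_neq0 AT_MLUB).
move=> t q Rts [qLU _].
(* The past value [e t], moved to [s], lies below every section of [tenseP R D]. *)
have below D e : D e -> lbound (sections (tenseP R D)) (set_at s (e t) \bot).
  by move=> De; apply/lbound_at => p pP; exact: tenseP_ge pP Rts De.
(* As [q] lies below all upper bounds of the products, [q t <= y s] follows once [y s], placed at
   [t], gives such a bound. *)
suff /qLU/lefP/(_ t) :
    ubound [set rmul b c | b in D1 & c in D2] (set_at t (y s) \top).
  by rewrite set_at_eq.
apply/ubound_at => _ [d1 Dd1 [d2 Dd2 <-]].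
have /lefP/(_ s) : rmul (set_at s (d1 t) \bot) (set_at s (d2 t) \bot) <= y.
  apply: yU; exists (set_at s (d1 t) \bot); first exact: below.
  by exists (set_at s (d2 t) \bot); first exact: below.
by rewrite {1}/rmul /= /fun_rmul !set_at_eq.
Qed.

End TenseInequalities.

Theorem theorem7p6 (d : Order.disp_t) (A : residuatedPOrderType d)
    (T : Type) (R : T -> T -> Prop)
    (A_MLUB : MLUB_complete A) (T_nonempty : inhabited T) (R_serial : serial R)
    (C1 C2 D1 D2 B1 B2 : set (T -> A))
    (C1_neq0 : C1 !=set0) (C2_neq0 : C2 !=set0)
    (D1_neq0 : D1 !=set0) (D2_neq0 : D2 !=set0)
    (B1_neq0 : B1 !=set0) (B2_neq0 : B2 !=set0) :
  let P := fun B : set (T -> A) => sections (tenseP R B) in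
  let F := fun B : set (T -> A) => sections (tenseF R B) in
  let H := fun B : set (T -> A) => sections (tenseH R B) in
  let G := fun B : set (T -> A) => sections (tenseG R B) in
  (* DT1 *)
  (set_le (boxdot (G (ubound C1)) (G (ubound C2)))
          (Min (ubound (G (ubound (boxdot C1 C2))))) /\
   set_le (G (boximp B1 B2)) (boximp (G (ubound B1)) (G (ubound B2)))) /\
  (* DT2 *)
  set_le (lbound (P (boxdot D1 D2)))
         (ubound (boxdot (lbound (P D1)) (lbound (P D2)))) /\
  (* DT3 *)
  (set_le (boxdot (H (ubound C1)) (H (ubound C2)))
          (Min (ubound (H (ubound (boxdot C1 C2))))) /\
   set_le (H (boximp B1 B2)) (boximp (H (ubound B1)) (H (ubound B2)))) /\
  (* DT4 *)
  set_le (lbound (F (boxdot D1 D2)))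
         (ubound (boxdot (lbound (F D1)) (lbound (F D2)))).
Proof.
move=> P F H G.
have Rc_serial : serial (fun s t => R t s).
  by move=> s; have [Rs sR] := R_serial s; split.
do 3?[split]; try split.
- exact: tenseG_boxdot.
- exact: tenseG_boximp.
- exact: tenseP_boxdot.
(* For the converse relation, [tenseG] and [tenseP] unfold to [tenseH R] and [tenseF R]. *)
- exact: (tenseG_boxdot (fun s t => R t s)).
- exact: (tenseG_boximp (fun s t => R t s)).
- exact: (tenseP_boxdot (fun s t => R t s)).
Qed.
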